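(* Let $U:\mathcal{A}\to\mathcal{B}$ be a Diers context and let $((X,\tau),\mathbb{B})$ be a $\mathcal{B}$-space. For each $(x,\xi)\in X_{\mathbb{B}}$ there is an isomorphism of sheaves of $\mathcal{B}$-objects on $(X_{\mathbb{B}|_x},\tau_{\mathbb{B}|_x})$ $$\iota_x^*\,\widetilde{\mathbb{B}}\simeq\widetilde{\mathbb{B}|_x},$$ where $\iota_x:(X_{\mathbb{B}|_x},\tau_{\mathbb{B}|_x})\to(X_{\mathbb{B}},\tau_{\mathbb{B}})$ is the continuous map $\xi\mapsto(x,\xi)$, $\widetilde{\mathbb{B}}$ is the structural sheaf of the spectrum of the $\mathcal{B}$-space $((X,\tau),\mathbb{B})$, and $\widetilde{\mathbb{B}|_x}$ is the structural sheaf of the spectrum of the object $\mathbb{B}|_x$ of $\mathcal{B}$.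
   Context: **Right multi-adjoints.** A functor $U:\mathcal{A}\to\mathcal{B}$ is right multi-adjoint if for every object $B$ of $\mathcal{B}$ there are a set $X_B$ and, for each $x\in X_B$, an object $A_x$ of $\mathcal{A}$ and an arrow $x:B\to U(A_x)$ (a *local unit* under $B$) such that for every $f:B\to U(A)$ there are a unique $x\in X_B$ and a unique $u:A_x\to A$ in $\mathcal{A}$ with $f=U(u)\circ x$. **Diagonally universal morphisms.** A morphism of $\mathcal{B}$ is diagonally universal if it is left orthogonal (unique lifting) to $U(u)$ for every arrow $u$ of $\mathcal{A}$. $\mathcal{D}$ is the category of diagonally universal morphisms between finitely presented objects of $\mathcal{B}$; $\mathcal{D}_B$ is the full subcategory of $B\downarrow\mathcal{B}$ on the pushouts $n:B\to C$ of morphisms $K\to K'$ of $\mathcal{D}$ along arbitrary maps $K\to B$. For $f:B\to B'$ and $n\in\mathcal{D}_B$, $f_*n\in\mathcal{D}_{B'}$ is the pushout of $n$ along $f$. For arrows $n,m$ out of $B$, $n\le m$ means $m=h\circ n$ for some $h$. For $x\in X_B$, $V_x$ is the full subcategory of $\mathcal{D}_B$ on the $n$ with $n\le x$. **Diers context.** $U:\mathcal{A}\to\mathcal{B}$ is a Diers context if $U$ is right multi-adjoint, $\mathcal{B}$ is locally finitely presentable, and every local unit $x$ under any $B$ is the filtered colimit in $B\downarrow\mathcal{B}$ of the $n\in V_x$. **Spectrum of an object $B$.** For $n\in\mathcal{D}_B$ put $D_n=\{x\in X_B\mid n\le x\}$; $\tau_B$ is the topology on $X_B$ generated by the $D_n$.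 The structural sheaf $\widetilde{B}$ on $(X_B,\tau_B)$ is the sheafification of the left Kan extension of $\mathrm{cod}:\mathcal{D}_B\to\mathcal{B}$ along $D:\mathcal{D}_B\to\tau_B^{op}$, i.e. of $w\mapsto\mathrm{colim}_{w\subseteq D_n}\mathrm{cod}(n)$. **Spectrum of a $\mathcal{B}$-space.** A $\mathcal{B}$-space $((X,\tau),\mathbb{B})$ is a topological space with a sheaf $\mathbb{B}:\tau^{op}\to\mathcal{B}$, with stalks $\mathbb{B}|_x=\mathrm{colim}_{x\in u}\mathbb{B}(u)$, restriction maps $\rho^u_v$ and canonical maps $\rho^u_x:\mathbb{B}(u)\to\mathbb{B}|_x$. Put $X_{\mathbb{B}}=\{(x,\xi)\mid x\in X,\ \xi\in X_{\mathbb{B}|_x}\}$. $\mathcal{D}_{\mathbb{B}}$ has as objects pairs $(u,n)$ with $u\in\tau$, $n\in\mathcal{D}_{\mathbb{B}(u)}$; a morphism $(u,n)\to(v,m)$ consists of an inclusion $v\subseteq u$ and a morphism $(\rho^u_v)_*n\to m$ in $\mathcal{D}_{\mathbb{B}(v)}$. Put $D_{(u,n)}=\{(x,\xi)\mid x\in u,\ (\rho^u_x)_*n\le\xi\}$; $\tau_{\mathbb{B}}$ is the topology generated by the $D_{(u,n)}$. The structural sheaf $\widetilde{\mathbb{B}}$ is the sheafification of the left Kan extension of $(u,n)\mapsto\mathrm{cod}(n)$ along $\mathcal{D}_{\mathbb{B}}\to\tau_{\mathbb{B}}^{op}$, $(u,n)\mapsto D_{(u,n)}$. $\iota_x^*$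 denotes inverse image of sheaves of $\mathcal{B}$-objects (left adjoint to the direct image $(\iota_x)_*$). *)

(* Defs.v *)
From HB Require Import structures.
From mathcomp Require Import all_boot all_order finmap.
From mathcomp Require Import all_classical topology_structure.

Set Implicit Arguments.
Unset Strict Implicit.
Unset Printing Implicit Defensive.

Local Open Scope classical_set_scope.

#[local] Obligation Tactic := try by [].

Declare Scope cat_scope.
Delimit Scope cat_scope with cat.

(* The universe of sets. Categories have a possibly large type of objects and
   small hom-sets. *)
Definition Small := Type.

Record Category := MkCategory {
  Ob :> Type ;
  Hom : Ob -> Ob -> Small ;
  idc : forall a, Hom a a ;
  comp : forall a b c, Hom b c -> Hom a b -> Hom a c ;
  compA : forall a b c d (h : Hom c d) (g : Hom b c) (f : Hom a b),
    comp h (comp g f) = comp (comp h g) f ;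
  comp1c : forall a b (f : Hom a b), comp (idc b) f = f ;
  compc1 : forall a b (f : Hom a b), comp f (idc a) = f }.

Arguments Hom {c} a b : rename.
Arguments idc {c} a : rename.
Arguments comp {c a b c0} g f : rename.

Notation "g ∘ f" := (comp g f) (at level 40, left associativity) : cat_scope.
Local Open Scope cat_scope.

Record Functor (C D : Category) := MkFunctor {
  fobj :> Ob C -> Ob D ;
  fmap : forall a b : C, Hom a b -> Hom (fobj a) (fobj b) ;
  fmap1 : forall a : C, fmap (idc a) = idc (fobj a) ;
  fmapM : forall (a b c : C) (g : Hom b c) (f : Hom a b),
    fmap (g ∘ f) = fmap g ∘ fmap f }.

Arguments fmap {C D} f {a b} u : rename.

Record NatTrans (C D : Category) (F G : Functor C D) := MkNatTrans {
  napp :> forall a : C, Hom (F a) (G a) ;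
  napp_nat : forall (a b : C) (u : Hom a b),
    fmap G u ∘ napp a = napp b ∘ fmap F u }.

Definition isomorphic (C : Category) (a b : C) : Prop :=
  exists (f : Hom a b) (g : Hom b a), g ∘ f = idc a /\ f ∘ g = idc b.

Program Definition opposite (C : Category) : Category :=
  @MkCategory (Ob C) (fun a b => Hom b a) (fun a => idc a)
    (fun a b c g f => f ∘ g) _ _ _.
Next Obligation. by move=> *; rewrite /= compA. Qed.
Next Obligation. by move=> *; rewrite /= compc1. Qed.
Next Obligation. by move=> *; rewrite /= comp1c. Qed.

Program Definition functor_comp (C D E : Category)
    (G : Functor D E) (F : Functor C D) : Functor C E :=
  @MkFunctor C E (fun a => G (F a)) (fun a b u => fmap G (fmap F u)) _ _.
Next Obligation. by move=> *; rewrite /= !fmap1. Qed.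
Next Obligation. by move=> *; rewrite /= !fmapM. Qed.

Program Definition functor_op (C D : Category) (F : Functor C D) :
    Functor (opposite C) (opposite D) :=
  @MkFunctor (opposite C) (opposite D) (fun a => F a) (fun a b u => fmap F u)
    _ _.
Next Obligation. by move=> *; rewrite /= fmap1. Qed.
Next Obligation. by move=> *; rewrite /= fmapM. Qed.

Program Definition full_sub (C : Category) (P : C -> Prop) : Category :=
  @MkCategory {c : C | P c} (fun a b => Hom (sval a) (sval b))
    (fun a => idc (sval a)) (fun a b c g f => g ∘ f) _ _ _.
Next Obligation. by move=> *; rewrite /= compA. Qed.
Next Obligation. by move=> *; rewrite /= comp1c. Qed.
Next Obligation. by move=> *; rewrite /= compc1. Qed.

Program Definition full_incl (C : Category) (P : C -> Prop) :
    Functor (full_sub P) C :=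
  @MkFunctor (full_sub P) C (fun a => sval a) (fun a b u => u) _ _.

Program Definition SetCat : Category :=
  @MkCategory Small (fun S T => S -> T) (fun S s => s)
    (fun S T V g f s => g (f s)) _ _ _.

Program Definition hom_functor (C : Category) (k : C) : Functor C SetCat :=
  @MkFunctor C SetCat (fun c => Hom k c) (fun a b u f => u ∘ f) _ _.
Next Obligation. by move=> C k a; apply: funext => f /=; rewrite comp1c. Qed.
Next Obligation. by move=> C k a b c g f; apply: funext => h /=; rewrite -compA. Qed.

Definition universal_arrow (C D : Category) (R : Functor C D) (d : D) (c : C)
    (eta : Hom d (R c)) : Prop :=
  forall (c' : C) (g : Hom d (R c')),
    exists! h : Hom c c', g = fmap R h ∘ eta.

Record Cocone (J C : Category) (F : Functor J C) (c : C) := MkCocone {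
  leg :> forall j : J, Hom (F j) c ;
  leg_nat : forall (i j : J) (u : Hom i j), leg j ∘ fmap F u = leg i }.

Definition is_colimit (J C : Category) (F : Functor J C) (c : C)
    (k : Cocone F c) : Prop :=
  forall (d : C) (l : Cocone F d),
    exists! h : Hom c d, forall j : J, h ∘ k j = l j.

Program Definition map_cocone (J C D : Category) (F : Functor J C) (c : C)
    (G : Functor C D) (k : Cocone F c) : Cocone (functor_comp G F) (G c) :=
  @MkCocone J D (functor_comp G F) (G c) (fun j => fmap G (k j)) _.
Next Obligation. by move=> *; rewrite /= -fmapM leg_nat. Qed.

Definition small_category (J : Category) : Prop :=
  exists (T : Small) (f : T -> Ob J), bijective f.

Definition cocomplete (C : Category) : Prop :=
  forall (J : Category) (F : Functor J C), small_category J ->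
    exists (c : C) (k : Cocone F c), is_colimit k.

Definition filtered (J : Category) : Prop :=
  [/\ exists j : J, True,
      forall i j : J, exists (k : J) (u : Hom i k) (v : Hom j k), True
    & forall (i j : J) (u v : Hom i j),
        exists (k : J) (w : Hom j k), w ∘ u = w ∘ v].

Definition preserves_filtered_colimits (C D : Category) (G : Functor C D) :
    Prop :=
  forall (J : Category) (F : Functor J C) (c : C) (k : Cocone F c),
    small_category J -> filtered J -> is_colimit k ->
    is_colimit (map_cocone G k).

Definition finitely_presented (C : Category) (k : C) : Prop :=
  preserves_filtered_colimits (hom_functor k).

Definition locally_finitely_presentable (C : Category) : Prop :=
  cocomplete C /\
  exists (I : Small) (g : I -> C),
    (forall i, finitely_presented (g i)) /\
    forall c : C, exists (J : Category) (F : Functor J C) (k : Cocone F c),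
      [/\ small_category J, filtered J, forall j, exists i, F j = g i
        & is_colimit k].

Definition is_pushout (C : Category) (a b c d : C) (f : Hom a b) (g : Hom a c)
    (i : Hom b d) (j : Hom c d) : Prop :=
  i ∘ f = j ∘ g /\
  forall (e : C) (u : Hom b e) (v : Hom c e), u ∘ f = v ∘ g ->
    exists! h : Hom d e, h ∘ i = u /\ h ∘ j = v.

(* The shape  Some true <- None -> Some false. *)
Definition span_le (a b : option bool) : Prop := (a == None) || (a == b).

Lemma span_le_refl a : span_le a a.
Proof. by rewrite /span_le eqxx orbT. Qed.

Lemma span_le_trans a b c : span_le b c -> span_le a b -> span_le a c.
Proof. by move: a b c => [[]|] [[]|] [[]|]. Qed.

Program Definition Span : Category :=
  @MkCategory (option bool) span_le span_le_refl span_le_trans _ _ _.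

Section SpanFunctor.
Variables (C : Category) (a b c : C) (f : Hom a b) (g : Hom a c).

Definition span_ob (o : option bool) : C :=
  match o with None => a | Some true => b | Some false => c end.

Definition span_map (o p : option bool) :
    span_le o p -> Hom (span_ob o) (span_ob p) :=
  match o, p return span_le o p -> Hom (span_ob o) (span_ob p) with
  | None, None => fun=> idc a
  | None, Some true => fun=> f
  | None, Some false => fun=> g
  | Some true, Some true => fun=> idc b
  | Some false, Some false => fun=> idc c
  | _, _ => fun u => False_rect _ (notF u)
  end.

Program Definition span_functor : Functor Span C :=
  @MkFunctor Span C span_ob span_map _ _.
Next Obligation. by case=> [[]|]. Qed.
Next Obligation.
by move=> [[]|] [[]|] [[]|] //= u v; rewrite ?comp1c ?compc1.
Qed.

End SpanFunctor.

Lemma cocomplete_pushout (C : Category) : cocomplete C ->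
  forall (a b c : C) (f : Hom a b) (g : Hom a c),
  exists (d : C) (i : Hom b d) (j : Hom c d), is_pushout f g i j.
Proof.
move=> cC a b c f g.
have [|d [k kP]] := cC Span (span_functor f g).
  by exists (option bool), id; exists id.
exists d, (k (Some true)), (k (Some false)).
have e1 := leg_nat k (erefl : @Hom Span None (Some true)).
have e2 := leg_nat k (erefl : @Hom Span None (Some false)).
split; first exact: etrans e1 (esym e2).
move=> e u v uv.
pose l (o : Span) : Hom (span_functor f g o) e :=
  match o return Hom (span_functor f g o) e with
  | None => u ∘ f | Some true => u | Some false => v end.
have lP (o p : Span) (w : Hom o p) : l p ∘ fmap (span_functor f g) w = l o.
  by case: o p w => [[]|] [[]|] //= w; rewrite ?compc1 ?uv.
have [h [hP hu]] := kP e (MkCocone lP).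
exists h; split; first by split; [exact: hP (Some true)|exact: hP (Some false)].
move=> h' [h1 h2]; apply: hu; case=> [[]|] //=.
by rewrite -[k None]e1 compA h1.
Qed.

Lemma pushout_uniq (C : Category) (a b c d : C) (f : Hom a b) (g : Hom a c)
    (i : Hom b d) (j : Hom c d) : is_pushout f g i j ->
  forall (e : C) (h h' : Hom d e), h ∘ i = h' ∘ i -> h ∘ j = h' ∘ j -> h = h'.
Proof.
move=> [ifg po] e h h' hi hj.
have [|h0 [_ hu]] := po e (h ∘ i) (h ∘ j); first by rewrite -!compA ifg.
by rewrite -(hu h)// (hu h').
Qed.

Lemma pushout_paste (C : Category) (a b c d b' d' : C)
    (f : Hom a b) (g : Hom a c) (i : Hom b d) (j : Hom c d)
    (f' : Hom c b') (i' : Hom d d') (j' : Hom b' d') :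
  is_pushout f g i j -> is_pushout j f' i' j' ->
  is_pushout f (f' ∘ g) (i' ∘ i) j'.
Proof.
move=> po1 po2; have [e1 u1] := po1; have [e2 u2] := po2.
split; first by rewrite -compA e1 !compA e2.
move=> e u v uv.
have [|h1 [[h1i h1j] _]] := u1 e u (v ∘ f'); first by rewrite uv compA.
have [|h [[hi hj] _]] := u2 e h1 v; first by [].
exists h; split; first by rewrite compA hi.
move=> h' [h'i h'j]; apply: (pushout_uniq po2); rewrite ?hj ?h'j//.
apply: (pushout_uniq po1); first by rewrite hi h1i -compA h'i.
by rewrite -!compA e2 !compA hj h'j.
Qed.

Section ChosenColimit.
Variables (C : Category) (cC : cocomplete C).

Section Colim.
Variables (J : Category) (F : Functor J C) (sJ : small_category J).

Definition colim : C := projT1 (cid (cC F sJ)).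
Definition colim_cocone : Cocone F colim := projT1 (cid (projT2 (cid (cC F sJ)))).
Lemma colimP : is_colimit colim_cocone.
Proof. exact: projT2 (cid (projT2 (cid (cC F sJ)))). Qed.
End Colim.

Section Pushout.
Variables (a b c : C) (f : Hom a b) (g : Hom a c).

Definition po : C := projT1 (cid (cocomplete_pushout cC f g)).
Definition po_in1 : Hom b po :=
  projT1 (cid (projT2 (cid (cocomplete_pushout cC f g)))).
Definition po_in2 : Hom c po :=
  projT1 (cid (projT2 (cid (projT2 (cid (cocomplete_pushout cC f g)))))).
Lemma poP : is_pushout f g po_in1 po_in2.
Proof.
exact: projT2 (cid (projT2 (cid (projT2 (cid (cocomplete_pushout cC f g)))))).
Qed.

Section Desc.
Variables (e : C) (u : Hom b e) (v : Hom c e) (uv : u ∘ f = v ∘ g).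
Lemma po_desc_ex : exists h : Hom po e, h ∘ po_in1 = u /\ h ∘ po_in2 = v.
Proof. by have [h [hP _]] := poP.2 _ _ _ uv; exists h. Qed.
Definition po_desc : Hom po e := projT1 (cid po_desc_ex).
Lemma po_desc1 : po_desc ∘ po_in1 = u.
Proof. exact: (projT2 (cid po_desc_ex)).1. Qed.
Lemma po_desc2 : po_desc ∘ po_in2 = v.
Proof. exact: (projT2 (cid po_desc_ex)).2. Qed.
End Desc.
End Pushout.
End ChosenColimit.

Record Under (C : Category) (b : C) := MkUnder {
  cod : C ;
  arr : Hom b cod }.

Program Definition Coslice (C : Category) (b : C) : Category :=
  @MkCategory (Under b) (fun n m => {h : Hom (cod n) (cod m) | h ∘ arr n = arr m})
    (fun n => exist _ (idc (cod n)) _)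
    (fun n m l g f => exist _ (sval g ∘ sval f) _) _ _ _.
Next Obligation. by move=> *; rewrite /= comp1c. Qed.
Next Obligation. by move=> C b n m l [g gP] [f fP] /=; rewrite -compA fP gP. Qed.
Next Obligation. by move=> *; apply: eq_exist; rewrite /= compA. Qed.
Next Obligation. by move=> C b n m [f fP]; apply: eq_exist; rewrite /= comp1c. Qed.
Next Obligation. by move=> C b n m [f fP]; apply: eq_exist; rewrite /= compc1. Qed.

Program Definition cod_functor (C : Category) (b : C) :
    Functor (Coslice b) C :=
  @MkFunctor (Coslice b) C (@cod C b) (fun n m h => sval h) _ _.

Section Kan.
Variables (C D E : Category) (K : Functor C D).

Record CommaOb (d : D) := MkCommaOb {
  comma_ob : C ;
  comma_arr : Hom (K comma_ob) d }.

Program Definition Comma (d : D) : Category :=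
  @MkCategory (CommaOb d)
    (fun p q => {u : Hom (comma_ob p) (comma_ob q) |
                  comma_arr q ∘ fmap K u = comma_arr p})
    (fun p => exist _ (idc (comma_ob p)) _)
    (fun p q r g f => exist _ (sval g ∘ sval f) _) _ _ _.
Next Obligation. by move=> *; rewrite /= fmap1 compc1. Qed.
Next Obligation.
by move=> d p q r [g gP] [f fP] /=; rewrite fmapM compA gP fP.
Qed.
Next Obligation. by move=> *; apply: eq_exist; rewrite /= compA. Qed.
Next Obligation. by move=> d p q [f fP]; apply: eq_exist; rewrite /= comp1c. Qed.
Next Obligation. by move=> d p q [f fP]; apply: eq_exist; rewrite /= compc1. Qed.

Program Definition comma_proj (d : D) : Functor (Comma d) C :=
  @MkFunctor (Comma d) C (@comma_ob d) (fun p q u => sval u) _ _.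

Variables (F : Functor C E) (L : Functor D E) (eta : NatTrans F (functor_comp L K)).

Program Definition kan_cocone (d : D) :
    Cocone (functor_comp F (comma_proj d)) (L d) :=
  @MkCocone _ _ (functor_comp F (comma_proj d)) (L d)
    (fun p => fmap L (comma_arr p) ∘ eta (comma_ob p)) _.
Next Obligation.
move=> d p q [u uP] /=.
have /= e := napp_nat eta u.
by rewrite -compA -[X in _ ∘ X]e compA -fmapM uP.
Qed.

(* Pointwise left Kan extension of F along K: L d is the colimit of F over the
   comma category of K over d. *)
Definition is_left_kan_extension : Prop :=
  forall d : D, is_colimit (kan_cocone d).

End Kan.

Record Opens (X : topologicalType) := MkOpens {
  oset :> set X ;
  oset_open : open oset }.

Program Definition OpensCat (X : topologicalType) : Category :=
  @MkCategory (Opens X) (fun u v => (u : set X) `<=` v)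
    (fun u => @subset_refl X u)
    (fun u v w vw uv => subset_trans uv vw) _ _ _.

Section Sheaves.
Variables (X : topologicalType) (C : Category).

Definition Presheaf := Functor (opposite (OpensCat X)) C.

Definition restr (F : Presheaf) (u v : Opens X) (vu : v `<=` u) :
    Hom (F u) (F v) :=
  @fmap (opposite (OpensCat X)) C F u v vu.

Lemma restr_comp (F : Presheaf) (u v w : Opens X) (vu : v `<=` u)
    (wv : w `<=` v) (wu : w `<=` u) :
  restr F wv ∘ restr F vu = restr F wu.
Proof.
rewrite (Prop_irrelevance wu (subset_trans wv vu)).
exact: esym (@fmapM (opposite (OpensCat X)) C F u v w wv vu).
Qed.

Record PresheafHom (F G : Presheaf) : Small := MkPresheafHom {
  papp :> forall u : Opens X, Hom (F u) (G u) ;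
  papp_nat : forall (u v : Opens X) (vu : v `<=` u),
    restr G vu ∘ papp u = papp v ∘ restr F vu }.

Lemma presheafHomP (F G : Presheaf) (s t : PresheafHom F G) :
  (forall u, s u = t u) -> s = t.
Proof.
case: s t => [s sP] [t tP] /= st.
have {}st : s = t by exact: functional_extensionality_dep.
by subst t; congr MkPresheafHom; exact: Prop_irrelevance.
Qed.

Program Definition PSh : Category :=
  @MkCategory Presheaf PresheafHom
    (fun F => @MkPresheafHom F F (fun u => idc (F u)) _)
    (fun F G H t s => @MkPresheafHom F H (fun u => t u ∘ s u) _) _ _ _.
Next Obligation. by move=> *; rewrite /= comp1c compc1. Qed.
Next Obligation. by move=> *; rewrite /= compA papp_nat -!compA papp_nat. Qed.
Next Obligation. by move=> *; apply: presheafHomP => u /=; rewrite compA. Qed.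
Next Obligation. by move=> *; apply: presheafHomP => u /=; rewrite comp1c. Qed.
Next Obligation. by move=> *; apply: presheafHomP => u /=; rewrite compc1. Qed.

(* For every open cover (w i) of v, F v is the limit of the diagram formed by
   the F (w i) and the F (w i `&` w j); limits are spelled out in terms of
   cones because C is not assumed to have products. Overlaps are represented
   by any open o equal, as a set, to w i `&` w j. *)
Definition is_sheaf (F : Presheaf) : Prop :=
  forall (I : Small) (w : I -> Opens X) (v : Opens X)
    (wv : forall i, w i `<=` v), v `<=` \bigcup_i w i ->
  forall (a : C) (s : forall i, Hom a (F (w i))),
    (forall (i j : I) (o : Opens X) (oi : o `<=` w i) (oj : o `<=` w j),
       (o : set X) = w i `&` w j -> restr F oi ∘ s i = restr F oj ∘ s j) ->
    exists! t : Hom a (F v), forall i, restr F (wv i) ∘ t = s i.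

Definition Sh : Category := @full_sub PSh is_sheaf.

Definition sh_incl : Functor Sh PSh := full_incl _.

Definition sheaf_psh (S : Sh) : Presheaf := sval S.

Definition is_sheafification (L : PSh) (F : Sh) : Prop :=
  exists eta : Hom L (sh_incl F), universal_arrow eta.

End Sheaves.

Section DirectImage.
Variables (X Y : topologicalType) (f : X -> Y) (cf : continuous f).
Variable C : Category.

Definition preim_open (v : Opens Y) : Opens X :=
  MkOpens ((continuousP f).1 cf v (oset_open v)).

Program Definition preim_functor : Functor (OpensCat Y) (OpensCat X) :=
  @MkFunctor (OpensCat Y) (OpensCat X) preim_open
    (fun u v (uv : (u : set Y) `<=` v) x => uv (f x)) _ _.
Next Obligation. by move=> * /=; apply: Prop_irrelevance. Qed.
Next Obligation. by move=> * /=; apply: Prop_irrelevance. Qed.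

Definition direct_psh (F : Presheaf X C) : Presheaf Y C :=
  functor_comp F (functor_op preim_functor).

Lemma direct_sheaf (F : Presheaf X C) : is_sheaf F -> is_sheaf (direct_psh F).
Proof.
move=> shF I w v wv vw a s sP.
have [|i j o oi oj oE|t [tP tu]] := shF I (preim_open \o w) (preim_open v)
    (fun i x => wv i (f x)) _ a s.
- by move=> x /vw[i _ ?]; exists i.
- have oo : open (w i `&` w j).
    by apply: openI; exact: oset_open.
  pose o' : Opens Y := MkOpens oo.
  have o'i : o' `<=` w i by move=> ? [].
  have o'j : o' `<=` w j by move=> ? [].
  have oo' : o `<=` preim_open o' by rewrite oE.
  have e := sP i j o' o'i o'j erefl.
  have /= {}e := congr1 (comp (restr F oo')) e.
  have r k (ok : o `<=` preim_open (w k)) (o'k : o' `<=` w k) :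
      restr F ok = restr F oo' ∘ restr (direct_psh F) o'k.
    exact: esym (@restr_comp _ _ F (preim_open (w k)) (preim_open o') o
      (fun x => o'k (f x)) oo' ok).
  by rewrite (r i oi o'i) (r j oj o'j) -!compA.
- by exists t; split.
Qed.

Program Definition direct_image : Functor (Sh X C) (Sh Y C) :=
  @MkFunctor (Sh X C) (Sh Y C)
    (fun F => exist _ (direct_psh (sval F)) (direct_sheaf (svalP F)))
    (fun F G s => @MkPresheafHom Y C (direct_psh (sval F)) (direct_psh (sval G))
                    (fun v => (s : PresheafHom _ _) (preim_open v)) _) _ _.
Next Obligation.
move=> F G s u v vu.
exact: (papp_nat (s : PresheafHom (sval F) (sval G)) (u := preim_open u)
  (v := preim_open v) (fun x => vu (f x))).
Qed.
Next Obligation. by move=> F; exact: presheafHomP. Qed.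
Next Obligation. by move=> F G H t s; exact: presheafHomP. Qed.

(* A universal arrow from G to the direct image functor, i.e. the value at G of
   its left adjoint together with the unit. *)
Definition is_inverse_image (G : Sh Y C) (P : Sh X C) : Prop :=
  exists eta : Hom G (direct_image P), universal_arrow eta.

End DirectImage.

Section Stalk.
Variables (X : topologicalType) (C : Category) (cC : cocomplete C).
Variables (F : Presheaf X C) (x : X).

Definition Nbhds : Category := @full_sub (OpensCat X) (fun u => oset u x).

Lemma small_Nbhds : small_category (opposite Nbhds).
Proof. by exists {u : Opens X | oset u x}, id; exists id. Qed.

Definition stalk_diag : Functor (opposite Nbhds) C :=
  functor_comp F (functor_op (full_incl _)).

Definition stalk : C := colim cC stalk_diag small_Nbhds.

Definition germ (u : Opens X) (xu : oset u x) : Hom (F u) stalk :=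
  colim_cocone cC stalk_diag small_Nbhds (exist _ u xu).

Lemma germ_restr (u v : Opens X) (vu : v `<=` u) (xu : oset u x) (xv : oset v x) :
  germ xv ∘ restr F vu = germ xu.
Proof.
exact: (leg_nat (colim_cocone cC stalk_diag small_Nbhds)
  (vu : @Hom (opposite Nbhds) (exist _ u xu) (exist _ v xv))).
Qed.

End Stalk.

Record RightMultiAdjoint (A B : Category) (U : Functor A B) := {
  locunit : B -> Small ;
  lu_ob : forall b, locunit b -> A ;
  lu_arr : forall b (x : locunit b), Hom b (U (lu_ob x)) ;
  lu_univ : forall (b : B) (a : A) (f : Hom b (U a)),
    exists! xu : {x : locunit b & Hom (lu_ob x) a},
      f = fmap U (projT2 xu) ∘ lu_arr (projT1 xu) }.

Definition left_orthogonal (B : Category) (k k' y z : B)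
    (n : Hom k k') (g : Hom y z) : Prop :=
  forall (s : Hom k y) (t : Hom k' z), g ∘ s = t ∘ n ->
    exists! d : Hom k' y, d ∘ n = s /\ g ∘ d = t.

Section DiagonallyUniversal.
Variables (A B : Category) (U : Functor A B).

Definition diag_universal (k k' : B) (n : Hom k k') : Prop :=
  forall (a a' : A) (u : Hom a a'), left_orthogonal n (fmap U u).

Definition in_D (k k' : B) (n : Hom k k') : Prop :=
  [/\ diag_universal n, finitely_presented k & finitely_presented k'].

Definition in_D_under (b : B) (n : Coslice b) : Prop :=
  exists (k k' : B) (d : Hom k k') (a : Hom k b) (a' : Hom k' (cod n)),
    in_D d /\ is_pushout d a a' (arr n).

Definition DCat (b : B) : Category := full_sub (@in_D_under b).

Definition DIncl (b : B) : Functor (DCat b) (Coslice b) := full_incl _.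

Definition Dcod (b : B) : Functor (DCat b) B :=
  functor_comp (cod_functor b) (DIncl b).

Definition Darr (b : B) (n : DCat b) : Hom b (Dcod b n) := arr (sval n).

End DiagonallyUniversal.

Definition le_under (B : Category) (b c d : B) (n : Hom b c) (m : Hom b d) :
  Prop := exists h : Hom c d, m = h ∘ n.

Section LocalUnitColimit.
Variables (A B : Category) (U : Functor A B) (M : RightMultiAdjoint U).
Variables (b : B) (x : locunit M b).

Definition VCat : Category :=
  @full_sub (DCat U b) (fun n => le_under (Darr n) (lu_arr x)).

Definition VIncl : Functor VCat (Coslice b) :=
  functor_comp (DIncl U b) (full_incl _).

(* A factorization of x through n need not be unique, so V_x carries no
   canonical cocone to x: some colimiting cocone with vertex x is required. *)
Definition unit_filtered_colimit : Prop :=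
  filtered VCat /\
  exists k : Cocone VIncl (MkUnder (lu_arr x)), is_colimit k.

End LocalUnitColimit.

Record DiersContext (A B : Category) (U : Functor A B) := {
  diers_multi :> RightMultiAdjoint U ;
  diers_lfp : locally_finitely_presentable B ;
  diers_units : forall (b : B) (x : locunit diers_multi b),
    unit_filtered_colimit x }.

(* T with the topology generated by the set S of subsets. *)
Definition generated_top (T : Type) (S : set (set T)) : Type := T.

Section GeneratedTop.
Variables (T : Type) (S : set (set T)).

HB.instance Definition _ := gen_eqMixin (generated_top S).
HB.instance Definition _ := gen_choiceMixin (generated_top S).
HB.instance Definition _ := isSubBaseTopological.Build (generated_top S) S id.

Lemma generated_open (V : set T) : S V -> open (V : set (generated_top S)).
Proof.
move=> SV; exists [set V]; last by rewrite bigcup_set1.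
move=> _ ->; exact: (finI_from1 id).
Qed.

Lemma generated_continuous (X : topologicalType) (f : X -> generated_top S) :
  (forall V, S V -> open (f @^-1` V)) -> continuous f.
Proof.
move=> fS; apply/continuousP => _ [D DS <-].
rewrite preimage_bigcup; apply: bigcup_open => W /DS[E ES <-].
rewrite openE => x Ex; apply: filter_bigI => V VE.
have := fS V (set_mem (ES _ VE)); rewrite openE; apply; exact: Ex.
Qed.

End GeneratedTop.

Section Spectrum.
Variables (A B : Category) (U : Functor A B) (M : DiersContext U).

Let cB : cocomplete B := (diers_lfp M).1.

Section Object.
Variable b : B.

Definition Dset (n : DCat U b) : set (locunit M b) :=
  [set x | le_under (Darr n) (lu_arr x)].

Definition Spec : topologicalType := generated_top [set V | exists n, V = Dset n].

Definition Dopen (n : DCat U b) : Opens Spec :=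
  @MkOpens Spec (Dset n) (generated_open (ex_intro _ n erefl)).

Lemma Dset_le (n m : DCat U b) : Hom n m -> Dset m `<=` Dset n.
Proof.
by case=> h hP x [g gP]; exists (g ∘ h); rewrite gP -compA; congr (_ ∘ _).
Qed.

Program Definition Dfunctor : Functor (DCat U b) (opposite (OpensCat Spec)) :=
  @MkFunctor (DCat U b) (opposite (OpensCat Spec)) Dopen
    (fun n m h => Dset_le h) _ _.
Next Obligation. by move=> * /=; apply: Prop_irrelevance. Qed.
Next Obligation. by move=> * /=; apply: Prop_irrelevance. Qed.

Definition is_structural_sheaf (F : Sh Spec B) : Prop :=
  exists (L : Presheaf Spec B)
         (eta : NatTrans (Dcod U b) (functor_comp L Dfunctor)),
    is_left_kan_extension eta /\ is_sheafification L F.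

End Object.

Section Pushforward.
Variables (b c : B) (f : Hom b c).

Definition push_under (n : DCat U b) : Coslice c :=
  MkUnder (po_in2 cB (Darr n) f).

Lemma push_in_D (n : DCat U b) : in_D_under U (push_under n).
Proof.
case: n => n [k [k' [d [a [a' [dD npo]]]]]].
exists k, k', d, (f ∘ a), (po_in1 cB (arr n) f ∘ a'); split=> //.
exact: pushout_paste npo (poP cB (arr n) f).
Qed.

Definition push (n : DCat U b) : DCat U c := exist _ (push_under n) (push_in_D n).

Definition push_in (n : DCat U b) : Hom (Dcod U b n) (Dcod U c (push n)) :=
  po_in1 cB (Darr n) f.

Lemma push_inP (n : DCat U b) : push_in n ∘ Darr n = Darr (push n) ∘ f.
Proof. exact: (poP cB (Darr n) f).1. Qed.

Section Maps.
Variables (n : DCat U b) (m : DCat U c).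

(* By the universal property of the pushout, g is determined by push_sq g; the
   composition of DSpace below is defined through this correspondence. *)
Definition push_sq (g : Hom (push n) m) : Hom (Dcod U b n) (Dcod U c m) :=
  sval g ∘ push_in n.

Lemma push_sqP (g : Hom (push n) m) : push_sq g ∘ Darr n = Darr m ∘ f.
Proof.
rewrite /push_sq -compA push_inP compA; congr (_ ∘ _); exact: svalP g.
Qed.

Lemma push_sq_inj (g h : Hom (push n) m) : push_sq g = push_sq h -> g = h.
Proof.
case: g h => [g gP] [h hP] gh; apply: eq_exist.
by apply: (pushout_uniq (poP cB (Darr n) f)) => //; exact: etrans gP (esym hP).
Qed.

Section Desc.
Variables (h : Hom (Dcod U b n) (Dcod U c m)) (hP : h ∘ Darr n = Darr m ∘ f).

Definition push_desc : Hom (push n) m :=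
  exist _ (po_desc cB hP) (po_desc2 cB hP).

Lemma push_descK : push_sq push_desc = h.
Proof. exact: po_desc1. Qed.
End Desc.
End Maps.
End Pushforward.

Section Space.
Variables (X : topologicalType) (S : Sh X B).

Let F : Presheaf X B := sheaf_psh S.

Definition bstalk (x : X) : B := stalk cB F x.

Record DSpaceOb := MkDSpaceOb {
  ds_open : Opens X ;
  ds_arr : DCat U (F ds_open) }.

Definition DSpaceHom (p q : DSpaceOb) : Small :=
  {vu : ds_open q `<=` ds_open p &
    Hom (push (restr F vu) (ds_arr p)) (ds_arr q)}.

Definition ds_cod (p : DSpaceOb) : B := Dcod U _ (ds_arr p).

Definition ds_map (p q : DSpaceOb) (g : DSpaceHom p q) :
    Hom (ds_cod p) (ds_cod q) := push_sq (projT2 g).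

Lemma ds_mapP (p q : DSpaceOb) (g : DSpaceHom p q) :
  ds_map g ∘ Darr (ds_arr p) = Darr (ds_arr q) ∘ restr F (projT1 g).
Proof. exact: push_sqP. Qed.

Lemma ds_map_inj (p q : DSpaceOb) (g h : DSpaceHom p q) :
  ds_map g = ds_map h -> g = h.
Proof.
case: g h => [i g] [j h]; rewrite (Prop_irrelevance j i) in h * => gh.
by congr existT; exact: push_sq_inj.
Qed.

Lemma ds_id_subproof (p : DSpaceOb) :
  idc (ds_cod p) ∘ Darr (ds_arr p) =
  Darr (ds_arr p) ∘ restr F (@subset_refl _ (ds_open p)).
Proof.
rewrite comp1c -[LHS]compc1; congr (_ ∘ _).
exact: esym (@fmap1 (opposite (OpensCat X)) B F (ds_open p)).
Qed.

Definition ds_id (p : DSpaceOb) : DSpaceHom p p :=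
  existT _ (@subset_refl _ (ds_open p)) (push_desc (ds_id_subproof p)).

Lemma ds_comp_subproof (p q r : DSpaceOb) (h : DSpaceHom q r)
    (g : DSpaceHom p q) :
  ds_map h ∘ ds_map g ∘ Darr (ds_arr p) =
  Darr (ds_arr r) ∘ restr F (subset_trans (projT1 h) (projT1 g)).
Proof.
rewrite -compA ds_mapP compA ds_mapP -compA; congr (_ ∘ _); exact: restr_comp.
Qed.

Definition ds_comp (p q r : DSpaceOb) (h : DSpaceHom q r)
    (g : DSpaceHom p q) : DSpaceHom p r :=
  existT _ (subset_trans (projT1 h) (projT1 g))
    (push_desc (ds_comp_subproof h g)).

Lemma ds_map_id (p : DSpaceOb) : ds_map (ds_id p) = idc (ds_cod p).
Proof. exact: push_descK. Qed.

Lemma ds_map_comp (p q r : DSpaceOb) (h : DSpaceHom q r) (g : DSpaceHom p q) :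
  ds_map (ds_comp h g) = ds_map h ∘ ds_map g.
Proof. exact: push_descK. Qed.

Program Definition DSpace : Category :=
  @MkCategory DSpaceOb DSpaceHom ds_id ds_comp _ _ _.
Next Obligation.
by move=> p q r s h g f; apply: ds_map_inj; rewrite !ds_map_comp compA.
Qed.
Next Obligation.
by move=> p q f; apply: ds_map_inj; rewrite ds_map_comp ds_map_id comp1c.
Qed.
Next Obligation.
by move=> p q f; apply: ds_map_inj; rewrite ds_map_comp ds_map_id compc1.
Qed.

Definition DSpace_cod : Functor DSpace B :=
  @MkFunctor DSpace B ds_cod ds_map ds_map_id ds_map_comp.

Definition SpSpace_pt : Type := {x : X & locunit M (bstalk x)}.

Definition DSpace_set (p : DSpace) : set SpSpace_pt :=
  [set z | exists xu : oset (ds_open p) (projT1 z),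
     le_under (Darr (push (germ cB F xu) (ds_arr p))) (lu_arr (projT2 z))].

Definition SpecSpace : topologicalType := generated_top [set V | exists p, V = DSpace_set p].

Definition DSpace_open (p : DSpace) : Opens SpecSpace :=
  @MkOpens SpecSpace (DSpace_set p) (generated_open (ex_intro _ p erefl)).

Lemma DSpace_set_le (p q : DSpace) :
  Hom p q -> DSpace_set q `<=` DSpace_set p.
Proof.
move=> g [x xi] [/= xv [h hP]].
have xu : oset (ds_open p) x := projT1 (g : DSpaceHom p q) x xv.
exists xu; pose k := h ∘ push_in (germ cB F xv) (ds_arr q) ∘ ds_map g.
have kP : k ∘ Darr (ds_arr p) = lu_arr xi ∘ germ cB F xu.
  rewrite /k -compA ds_mapP compA -(compA h) push_inP compA -hP -compA.
  congr (_ ∘ _); exact: germ_restr.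
by exists (po_desc cB kP); rewrite [RHS](po_desc2 cB kP).
Qed.

Program Definition DSpace_functor :
    Functor DSpace (opposite (OpensCat SpecSpace)) :=
  @MkFunctor DSpace (opposite (OpensCat SpecSpace)) DSpace_open
    (fun p q g => DSpace_set_le g) _ _.
Next Obligation. by move=> * /=; apply: Prop_irrelevance. Qed.
Next Obligation. by move=> * /=; apply: Prop_irrelevance. Qed.

Definition is_structural_sheaf_space (G : Sh SpecSpace B) : Prop :=
  exists (L : Presheaf SpecSpace B)
         (eta : NatTrans DSpace_cod (functor_comp L DSpace_functor)),
    is_left_kan_extension eta /\ is_sheafification L G.

Definition iota (x : X) : Spec (bstalk x) -> SpecSpace :=
  fun xi => existT (fun x => locunit M (bstalk x)) x xi.

Lemma iota_continuous (x : X) : continuous (@iota x).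
Proof.
apply: generated_continuous => _ [p ->].
have [xu|nxu] := pselect (oset (ds_open p) x).
  rewrite (_ : _ @^-1` _ = Dset (push (germ cB F xu) (ds_arr p))).
    exact: (oset_open (Dopen _)).
  apply/seteqP; split=> [xi [/= xu']|xi ?]; last by exists xu.
  by rewrite (Prop_irrelevance xu' xu).
rewrite (_ : _ @^-1` _ = set0); first exact: open0.
by apply/seteqP; split=> // xi [/= xu]; case: nxu.
Qed.

End Space.
End Spectrum.

(* Main.v *)
Require Import Defs.
From mathcomp Require Import all_boot all_order finmap.
From mathcomp Require Import all_classical topology_structure.
(* The libraries above shadow [fmap]. *)
Import Defs.

Set Implicit Arguments.
Unset Strict Implicit.
Unset Printing Implicit Defensive.

Local Open Scope classical_set_scope.
Local Open Scope cat_scope.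

(** Both sheaves represent the same functor. By the universal properties of the
    inverse image, of sheafification and of the left Kan extension, maps from
    the left hand side to a sheaf P are the natural families of maps
    cod(n) -> P(D_m), one for each (u,n) with x in u, where m is the pushforward
    of n to the stalk (if x is not in u, then the open set is empty and its
    sections form a terminal object). Maps from the right hand side to P are the
    natural families cod(m) -> P(D_m), for m in D over the stalk. Every such m
    is a pushout of some d : k -> k' in D along a map which, k being finitely
    presented, is defined on a neighbourhood w of x. So cod(m) is the filtered
    colimit of the pushouts of d to the neighbourhoods of x, and since k and k'
    are finitely presented every map cod(n) -> cod(m) over the germ map factors
    through one of them. Hence the two kinds of families determine each
    other. *)

(** * Filtered colimits of sets and maps out of finitely presented objects *)

Section FilteredSets.
Variables (J : Category) (F : Functor J SetCat) (c : SetCat) (k : Cocone F c).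
Hypothesis kP : is_colimit k.

(** [Prop] serves as a subobject classifier: the image predicate and the constant [True] both
    restrict to [True] on every [F j], so uniqueness of maps out of the colimit identifies them. *)
Lemma set_colimit_surj (y : c) : exists (j : J) (s : F j), k j s = y.
Proof.
pose l (j : J) : Hom (F j) (Prop : SetCat) := fun=> True.
have lP (i j : J) (u : Hom i j) : l j ∘ fmap F u = l i by [].
have [h [_ hu]] := kP (MkCocone lP).
pose im : Hom (c : SetCat) (Prop : SetCat) :=
  fun y => exists (j : J) (s : F j), k j s = y.
have e : h = im.
  apply: hu => j; apply: funext => s /=.
  by apply/propext; split=> // _; exists j, s.
by rewrite -/(im y) -e (hu (fun=> True)).
Qed.

Hypothesis Jf : filtered J.

(** With [s] fixed, the predicate of becoming equal to [s] at some later stage is a cocone to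
    [Prop], hence descends to [c]. It holds at [s] itself, so it holds at every [t] with the same
    image. *)
Lemma set_colimit_eq (i j : J) (s : F i) (t : F j) : k i s = k j t ->
  exists (l : J) (u : Hom i l) (v : Hom j l), fmap F u s = fmap F v t.
Proof.
have [_ Jpair Jeq] := Jf => st.
pose q (j' : J) : Hom (F j') (Prop : SetCat) := fun t' =>
  exists (l : J) (u : Hom i l) (v : Hom j' l), fmap F u s = fmap F v t'.
have qP (a b : J) (w : Hom a b) : q b ∘ fmap F w = q a.
  apply: funext => t' /=; apply/propext.
  split=> [[l [u [v uv]]]|[l [u [v uv]]]].
    by exists l, u, (v ∘ w); rewrite fmapM.
  (* Bring [l] and [b] to a common stage, then equalise the two resulting maps out of [a]. *)
  have [l1 [v1 [w1 _]]] := Jpair l b.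
  have [l2 [r rP]] := Jeq _ _ (v1 ∘ v) (w1 ∘ w).
  exists l2, (r ∘ v1 ∘ u), (r ∘ w1).
  have -> : fmap F (r ∘ v1 ∘ u) s = fmap F (r ∘ v1) (fmap F u s).
    by rewrite fmapM.
  have -> : fmap F (r ∘ w1) (fmap F w t') = fmap F (r ∘ w1 ∘ w) t'.
    by rewrite [in RHS]fmapM.
  by rewrite uv -(compA r w1) -rP compA [in RHS]fmapM.
have [h [hP _]] := kP (MkCocone qP).
have e (a : J) (r : F a) : h (k a r) = q a r by rewrite -[q a]hP.
rewrite -/(q j t) -e -st e.
by exists i, (idc i), (idc i).
Qed.

End FilteredSets.

Section FinitelyPresented.
Variables (C : Category) (J : Category) (F : Functor J C) (c : C).
Variables (k : Cocone F c) (sJ : small_category J) (fJ : filtered J).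
Hypothesis kP : is_colimit k.
Variables (a : C) (fpa : finitely_presented a).

Lemma fp_factor (f : Hom a c) : exists (j : J) (g : Hom a (F j)), k j ∘ g = f.
Proof. exact: set_colimit_surj (fpa sJ fJ kP) f. Qed.

(** The equality of elements in the colimit of hom-sets is witnessed by two transition maps out of
    [i] that may differ; filteredness equalises them into a single one. *)
Lemma fp_factor_eq (i : J) (f g : Hom a (F i)) : k i ∘ f = k i ∘ g ->
  exists (j : J) (u : Hom i j), fmap F u ∘ f = fmap F u ∘ g.
Proof.
move=> fg.
have [l [u [v uv]]] := set_colimit_eq (fpa sJ fJ kP) fJ fg.
have [_ _ Jeq] := fJ; have [r [w wP]] := Jeq _ _ u v.
exists r, (w ∘ u); rewrite {2}wP !fmapM -!compA; congr (_ ∘ _); exact: uv.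
Qed.

End FinitelyPresented.

(** * Maps out of colimits, restriction maps, and sheaves on the empty set *)

Lemma colimit_uniq (J C : Category) (F : Functor J C) (c : C)
    (k : Cocone F c) : is_colimit k ->
  forall (d : C) (f g : Hom c d), (forall j, f ∘ k j = g ∘ k j) -> f = g.
Proof.
move=> kP d f g fg.
have lP (i j : J) (u : Hom i j) : g ∘ k j ∘ fmap F u = g ∘ k i.
  by rewrite -compA leg_nat.
by have [h [_ hu]] := kP d (MkCocone lP); rewrite -(hu f)// (hu g).
Qed.

Lemma restr_id (X : topologicalType) (C : Category) (F : Presheaf X C)
    (u : Opens X) (uu : u `<=` u) : restr F uu = idc (F u).
Proof.
rewrite (Prop_irrelevance uu (@subset_refl _ u)).
exact: (@fmap1 (opposite (OpensCat X)) C F u).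
Qed.

(** The empty family covers the empty open set, so the sheaf condition makes the value there a
    terminal object. *)
Lemma sheaf_empty_uniq (X : topologicalType) (C : Category) (F : Presheaf X C)
    (v : Opens X) (a : C) (s t : Hom a (F v)) :
  is_sheaf F -> (v : set X) = set0 -> s = t.
Proof.
move=> shF v0.
have [||r [_ ru]] := shF void (fun i => match i with end) v
    (fun i => match i with end) _ a (fun i => match i with end).
- by rewrite v0; exact: sub0set.
- by case.
by rewrite -(ru s)// ?(ru t)//; case.
Qed.

Lemma sheaf_empty_ex (X : topologicalType) (C : Category) (F : Presheaf X C)
    (v : Opens X) (a : C) :
  is_sheaf F -> (v : set X) = set0 -> exists t : Hom a (F v), True.
Proof.
move=> shF v0.
have [||r _] := shF void (fun i => match i with end) v
    (fun i => match i with end) _ a (fun i => match i with end).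
- by rewrite v0; exact: sub0set.
- by case.
by exists r.
Qed.

(** * Left Kan extension among sheaves *)

Section SheafExtension.
Variables (X : topologicalType) (C D : Category).
Variables (K : Functor D (opposite (OpensCat X))) (F : Functor D C).

(** The global form of the left Kan extension property, tested against sheaves only; it determines
    [P] up to isomorphism. *)
Definition sheaf_extension (P : Sh X C)
    (eta : NatTrans F (functor_comp (sheaf_psh P) K)) : Prop :=
  forall (Q : Sh X C) (theta : NatTrans F (functor_comp (sheaf_psh Q) K)),
    exists! s : Hom P Q,
      forall d, (s : PresheafHom _ _) (K d) ∘ eta d = theta d.

(** A transformation [theta] into a sheaf [Q] gives a cocone over each comma category, hence a
    presheaf map from [L] to [Q], which factors uniquely through the sheafification. *)
Lemma sheafified_kan_extension (L : Presheaf X C)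
    (eta : NatTrans F (functor_comp L K)) (P : Sh X C) :
  is_left_kan_extension eta -> is_sheafification L P ->
  exists eta' : NatTrans F (functor_comp (sheaf_psh P) K),
    sheaf_extension eta'.
Proof.
move=> kanL [e eP].
pose e' : PresheafHom L (sheaf_psh P) := e.
have etaN (a b : D) (u : Hom a b) :
    fmap (functor_comp (sheaf_psh P) K) u ∘ (e' (K a) ∘ eta a) =
    e' (K b) ∘ eta b ∘ fmap F u.
  rewrite compA; have /= -> := papp_nat e' (fmap K u).
  by rewrite -!compA; congr (_ ∘ _); exact: (napp_nat eta u).
exists (MkNatTrans etaN) => Q theta.
have lP (v : Opens X) (p q : Comma K v) (u : Hom p q) :
    fmap (sheaf_psh Q) (comma_arr q) ∘ theta (comma_ob q) ∘
      fmap F (sval u) =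
    fmap (sheaf_psh Q) (comma_arr p) ∘ theta (comma_ob p).
  have /= en := napp_nat theta (sval u).
  by rewrite -compA -en compA -fmapM (svalP u).
pose l v := @MkCocone (Comma K v) C (functor_comp F (comma_proj K v))
  (sheaf_psh Q v)
  (fun p => fmap (sheaf_psh Q) (comma_arr p) ∘ theta (comma_ob p))
  (@lP v).
pose t v := projT1 (cid (kanL v _ (l v))).
have tP v p : t v ∘ kan_cocone eta v p = l v p.
  exact: (projT2 (cid (kanL v _ (l v)))).1.
have tN (u v : Opens X) (vu : v `<=` u) :
    restr (sheaf_psh Q) vu ∘ t u = t v ∘ restr L vu.
  apply: (colimit_uniq (kanL u)) => p.
  (* Composing [p] with the restriction to [v] gives an object of the comma category over [v]; both
     sides of naturality equal its leg. *)
  pose p' : Comma K v := MkCommaOb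
    ((vu : @Hom (opposite (OpensCat X)) u v) ∘ comma_arr p).
  transitivity (restr (sheaf_psh Q) vu ∘ l u p).
    by rewrite -compA; congr (_ ∘ _); exact: tP.
  transitivity (l v p'); first by rewrite /= fmapM -compA.
  rewrite -[l v p']tP -[RHS]compA; congr (_ ∘ _).
  by rewrite /= fmapM -compA.
pose t' : Hom (L : PSh X C) (sh_incl X C Q) := MkPresheafHom tN.
have [s [sE su]] := eP Q t'.
(* The identity of [K d] is an object of the comma category over [K d]; its leg recovers [eta d]. *)
have leg1 (d : D) : kan_cocone eta (K d) (MkCommaOb (idc (K d))) = eta d.
  by rewrite /= fmap1 comp1c.
exists s; split.
  move=> d.
  have sEv : (s : PresheafHom _ _) (K d) ∘ e' (K d) = t (K d).
    by rewrite -[RHS]/(papp (t' : PresheafHom _ _) (K d)) sE.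
  transitivity (t (K d) ∘ kan_cocone eta (K d) (MkCommaOb (idc (K d)))).
    by rewrite -sEv leg1 [LHS]compA.
  by rewrite tP /= fmap1 comp1c.
move=> s' s'E; apply: su; apply: presheafHomP => v.
apply: (colimit_uniq (kanL v)) => p; apply: etrans (tP v p) _.
transitivity (fmap (sheaf_psh Q) (comma_arr p) ∘
    ((s' : PresheafHom _ _) (K (comma_ob p)) ∘
      (e' (K (comma_ob p)) ∘ eta (comma_ob p)))).
  by congr (_ ∘ _); rewrite -s'E.
transitivity ((s' : PresheafHom _ _) v ∘ e' v ∘
    (fmap L (comma_arr p) ∘ eta (comma_ob p))); last by [].
rewrite !compA; congr (_ ∘ _).
have e1 := papp_nat (s' : PresheafHom _ _) (comma_arr p).
have e2 := papp_nat e' (comma_arr p).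
rewrite -[RHS]compA -[X in _ = _ ∘ X]e2 [RHS]compA; congr (_ ∘ _).
exact: e1.
Qed.

Lemma sheaf_extension_iso (P Q : Sh X C)
    (eta : NatTrans F (functor_comp (sheaf_psh P) K))
    (theta : NatTrans F (functor_comp (sheaf_psh Q) K)) :
  sheaf_extension eta -> sheaf_extension theta -> isomorphic P Q.
Proof.
move=> etaP thetaP.
have [s [sE _]] := etaP Q theta; have [t [tE _]] := thetaP P eta.
have [r [_ ru]] := etaP P eta; have [q [_ qu]] := thetaP Q theta.
exists s, t; split.
  rewrite -(ru (t ∘ s)) ?(ru (idc P))// => d /=; first by rewrite comp1c.
  by rewrite -compA sE tE.
rewrite -(qu (s ∘ t)) ?(qu (idc Q))// => d /=; first by rewrite comp1c.
by rewrite -compA tE sE.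
Qed.

End SheafExtension.

(** Maps from [P] to [Q] are maps from [G] to the direct image of [Q], whose composite with [K] is
    [Q] evaluated on preimages. So the universal property passes to [P], with [K] followed by taking
    preimages. *)
Lemma inverse_image_extension (X Y : topologicalType) (f : X -> Y)
    (cf : continuous f) (C D : Category)
    (K : Functor D (opposite (OpensCat Y))) (F : Functor D C)
    (G : Sh Y C) (P : Sh X C)
    (eta : NatTrans F (functor_comp (sheaf_psh G) K)) :
  sheaf_extension eta -> is_inverse_image cf G P ->
  exists eta' : NatTrans F (functor_comp (sheaf_psh P)
      (functor_comp (functor_op (preim_functor cf)) K)),
    sheaf_extension eta'.
Proof.
move=> etaP [e eP].
pose e' : PresheafHom (sheaf_psh G) (direct_psh cf (sheaf_psh P)) := e.
have etaN (a b : D) (u : Hom a b) :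
    fmap (functor_comp (sheaf_psh P)
      (functor_comp (functor_op (preim_functor cf)) K)) u ∘
      (e' (K a) ∘ eta a) =
    e' (K b) ∘ eta b ∘ fmap F u.
  rewrite compA; have /= -> := papp_nat e' (fmap K u).
  by rewrite -!compA; congr (_ ∘ _); exact: (napp_nat eta u).
exists (MkNatTrans etaN) => Q theta.
have thetaN (a b : D) (u : Hom a b) :
    fmap (functor_comp (sheaf_psh (direct_image cf C Q)) K) u ∘ theta a =
    (theta b : Hom (F b) (sheaf_psh (direct_image cf C Q) (K b))) ∘ fmap F u.
  exact: (napp_nat theta u).
have [t [tE tu]] := etaP _ (MkNatTrans thetaN).
have [s [sE su]] := eP Q t.
exists s; split.
  move=> d; rewrite -[theta d]tE sE /=; exact: compA.
move=> s' s'E; apply: su; apply: tu => d.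
by rewrite -[RHS]s'E /= compA.
Qed.

(** * Pushouts over a stalk as filtered colimits over neighbourhoods *)

Lemma filtered_Nbhds (X : topologicalType) (x : X) :
  filtered (opposite (Nbhds x)).
Proof.
split.
- by exists (exist _ (MkOpens (@openT X)) I).
- move=> [u xu] [v xv].
  pose w : Nbhds x := exist (fun u : Opens X => oset u x)
    (MkOpens (openI (oset_open u) (oset_open v))) (conj xu xv).
  by exists w, (@subIsetl _ u v), (@subIsetr _ u v).
move=> [u xu] [v xv] p q; exists (exist _ v xv), (@subset_refl _ v).
by have -> : p = q by exact: (@Prop_irrelevance (oset v `<=` u)).
Qed.

Section StalkPushout.
Variables (X : topologicalType) (C : Category) (cC : cocomplete C).
Variables (F : Presheaf X C) (x : X) (w : Opens X) (xw : oset w x).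
Variables (k k' c : C) (d : Hom k k') (b : Hom k (F w)).
Variables (i : Hom k' c) (j : Hom (stalk cC F x) c).
Hypothesis ijP : is_pushout d (germ cC F xw ∘ b) i j.

Definition cap_open (v : Opens X) : Opens X :=
  MkOpens (openI (oset_open v) (oset_open w)).

Lemma cap_openl (v : Opens X) : cap_open v `<=` v. Proof. exact: subIsetl. Qed.

Lemma cap_openr (v : Opens X) : cap_open v `<=` w. Proof. exact: subIsetr. Qed.

Definition local_map (v : Opens X) : Hom k (F (cap_open v)) :=
  restr F (@cap_openr v) ∘ b.

(* As [v] ranges over the neighbourhoods of [x], the colimit of the [local_po v]
   is [c]; intersecting with [w] lets all of them serve as indices. *)
Definition local_po (v : Opens X) : C := po cC d (local_map v).

Definition local_in1 (v : Opens X) : Hom k' (local_po v) :=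
  po_in1 cC d (local_map v).

Definition local_in2 (v : Opens X) : Hom (F (cap_open v)) (local_po v) :=
  po_in2 cC d (local_map v).

Lemma local_poP v : is_pushout d (local_map v) (local_in1 v) (local_in2 v).
Proof. exact: poP. Qed.

Lemma local_leg_eq v (xv : oset v x) :
  i ∘ d = j ∘ germ cC F (conj xv xw : oset (cap_open v) x) ∘ local_map v.
Proof.
rewrite ijP.1 /local_map -compA; congr (_ ∘ _).
by rewrite compA germ_restr.
Qed.

Definition local_leg v (xv : oset v x) : Hom (local_po v) c :=
  po_desc cC (local_leg_eq xv).

Lemma local_leg1 v (xv : oset v x) : local_leg xv ∘ local_in1 v = i.
Proof. exact: po_desc1. Qed.

Lemma local_leg2 v (xv : oset v x) :
  local_leg xv ∘ local_in2 v =
  j ∘ germ cC F (conj xv xw : oset (cap_open v) x).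
Proof. exact: po_desc2. Qed.

Lemma cap_openS (u v : Opens X) : v `<=` u -> cap_open v `<=` cap_open u.
Proof. exact: setSI. Qed.

Lemma local_trans_eq (u v : Opens X) (vu : v `<=` u) :
  local_in1 v ∘ d = local_in2 v ∘ restr F (cap_openS vu) ∘ local_map u.
Proof.
rewrite (local_poP v).1 -compA; congr (_ ∘ _).
rewrite /local_map compA; congr (_ ∘ _); exact/esym/restr_comp.
Qed.

Definition local_trans (u v : Opens X) (vu : v `<=` u) :
    Hom (local_po u) (local_po v) := po_desc cC (local_trans_eq vu).

Lemma local_trans1 (u v : Opens X) (vu : v `<=` u) :
  local_trans vu ∘ local_in1 u = local_in1 v.
Proof. exact: po_desc1. Qed.

Lemma local_trans2 (u v : Opens X) (vu : v `<=` u) :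
  local_trans vu ∘ local_in2 u = local_in2 v ∘ restr F (cap_openS vu).
Proof. exact: po_desc2. Qed.

Lemma local_trans_id (u : Opens X) (uu : u `<=` u) :
  local_trans uu = idc (local_po u).
Proof.
apply: (pushout_uniq (local_poP u)); rewrite comp1c ?local_trans1//.
by rewrite local_trans2 restr_id compc1.
Qed.

Lemma local_trans_comp (u v t : Opens X) (vu : v `<=` u) (tv : t `<=` v)
    (tu : t `<=` u) :
  local_trans tu = local_trans tv ∘ local_trans vu.
Proof.
apply: (pushout_uniq (local_poP u)); rewrite -compA.
  by rewrite !local_trans1.
rewrite !local_trans2 compA local_trans2 -compA; congr (_ ∘ _).
exact/esym/restr_comp.
Qed.

Definition local_diag : Functor (opposite (Nbhds x)) C :=
  @MkFunctor (opposite (Nbhds x)) C (fun v => local_po (sval v))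
    (fun u v vu => local_trans vu)
    (fun u => local_trans_id _) (fun u v t tv vu => local_trans_comp _ _ _).

Lemma local_leg_trans (u v : Opens X) (vu : v `<=` u) (xu : oset u x)
    (xv : oset v x) :
  local_leg xv ∘ local_trans vu = local_leg xu.
Proof.
apply: (pushout_uniq (local_poP u)); rewrite -compA.
  by rewrite local_trans1 !local_leg1.
rewrite local_trans2 compA !local_leg2 -compA; congr (_ ∘ _).
exact: germ_restr.
Qed.

Definition local_cocone : Cocone local_diag c :=
  @MkCocone _ _ local_diag c (fun v => local_leg (proj2_sig v))
    (fun u v vu => local_leg_trans _ _ _).

(* Colimits commute with pushouts. *)
Lemma local_coconeP : is_colimit local_cocone.
Proof.
move=> e l.
pose f v (xv : oset v x) : Hom (local_po v) e := l (exist _ v xv).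
have fE u v (xu : oset u x) (xv : oset v x) (vu : v `<=` u) :
    f v xv ∘ local_trans vu = f u xu.
  exact: (leg_nat l
    (vu : @Hom (opposite (Nbhds x)) (exist _ u xu) (exist _ v xv))).
(* [local_po v] only receives sections over the intersection with [w], so sections over [v] are
   restricted first. This gives a cocone on the stalk diagram, hence the map [h] out of the
   stalk. *)
pose t v (xv : oset v x) : Hom (F v) e :=
  f v xv ∘ local_in2 v ∘ restr F (@cap_openl v).
have tP u v (xu : oset u x) (xv : oset v x) (vu : v `<=` u) :
    t v xv ∘ restr F vu = t u xu.
  rewrite /t -(fE u v xu xv vu) -!compA (compA (local_trans _)) local_trans2.
  rewrite -!compA.
  congr (_ ∘ (_ ∘ _)).
  rewrite (restr_comp _ _ _ (subset_trans (@cap_openl v) vu)).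
  exact/esym/restr_comp.
pose tc := @MkCocone (opposite (Nbhds x)) C (stalk_diag F x) e
  (fun v => t (sval v) (proj2_sig v)) (fun u v vu => tP _ _ _ _ vu).
have [h [hc _]] := colimP cC (small_Nbhds x) tc.
have hP v (xv : oset v x) : h ∘ germ cC F xv = t v xv := hc (exist _ v xv).
(* The map out of [k'] does not depend on the neighbourhood: every one is compared with the whole
   space. *)
have f1 u v (xu : oset u x) (xv : oset v x) :
    f u xu ∘ local_in1 u = f v xv ∘ local_in1 v.
  have xT : oset (MkOpens (@openT X)) x by [].
  suff s u' (xu' : oset u' x) :
    f _ xT ∘ local_in1 _ = f u' xu' ∘ local_in1 u'.
    by rewrite -!s.
  by rewrite -(fE _ u' xT xu' (fun=> fun=> I)) -compA local_trans1.
have f2 v (xv : oset v x) : f v xv ∘ local_in2 v =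
    h ∘ germ cC F (conj xv xw : oset (cap_open v) x).
  rewrite hP /t -(fE _ _ xv (conj xv xw : oset (cap_open v) x) (@cap_openl v)).
  rewrite -compA local_trans2 compA; congr (_ ∘ restr _ _).
  exact: Prop_irrelevance.
(* The common map out of [k'], taken at stage [w], agrees with [h] on [k], so the pushout [c]
   provides the map to [e]. *)
have hd : f w xw ∘ local_in1 w ∘ d = h ∘ (germ cC F xw ∘ b).
  rewrite -compA (local_poP w).1 compA f2 /local_map -!compA.
  congr (_ ∘ _); rewrite compA; congr (_ ∘ _); exact: germ_restr.
have [g [[g1 g2] gu]] := ijP.2 _ _ _ hd.
exists g; split.
  case=> v xv; rewrite -[RHS]/(f v xv) -[leg _ _]/(local_leg xv).
  apply: (pushout_uniq (local_poP v)); rewrite -compA.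
    by rewrite local_leg1 g1; exact: f1.
  by rewrite local_leg2 f2 -g2 compA.
move=> g' g'P.
have {}g'P v (xv : oset v x) : g' ∘ local_leg xv = f v xv.
  by rewrite -[f v xv]g'P.
apply: gu; split; first by rewrite -(g'P w xw) -compA local_leg1.
(* On the stalk, uniqueness is tested on germs; a germ over [v] factors through the intersection
   with [w], where [local_leg2] applies. *)
apply: (colimit_uniq (colimP cC (small_Nbhds x))) => -[v xv].
rewrite -[leg _ _]/(germ cC F xv).
rewrite -(germ_restr cC F (@cap_openl v) xv (conj xv xw)).
rewrite !compA; congr (_ ∘ _).
by rewrite -compA -local_leg2 compA g'P f2.
Qed.

End StalkPushout.

(** * The fibre of the spectrum over a point, and approximation of objects of D over the stalk *)

Section StalkSpectrum.
Variables (A B : Category) (U : Functor A B) (M : DiersContext U).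
Variables (X : topologicalType) (S : Sh X B) (x : X).

Local Notation cB := (diers_lfp M).1.
Local Notation F := (sheaf_psh S).
Local Notation Bx := (bstalk M S x).

(** Such [h] correspond to the morphisms to [m] from the pushforward of [ds_arr p] to the stalk; the
    square form composes without mentioning the chosen pushout. *)
Definition over_germ (p : DSpaceOb U S) (xp : oset (ds_open p) x)
    (m : DCat U Bx) (h : Hom (ds_cod p) (Dcod U Bx m)) : Prop :=
  h ∘ Darr (ds_arr p) = Darr m ∘ germ cB F xp.

Definition fibre_open (p : DSpaceOb U S) : Opens (Spec M Bx) :=
  preim_open (@iota_continuous A B U M X S x) (DSpace_open p).

Lemma fibre_openE (p : DSpaceOb U S) (xp : oset (ds_open p) x) :
  (fibre_open p : set _) = Dset (push M (germ cB F xp) (ds_arr p)).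
Proof.
apply/seteqP; split=> [xi [/= xu']|xi ?]; last by exists xp.
by rewrite (Prop_irrelevance xu' xp).
Qed.

Lemma fibre_open0 (p : DSpaceOb U S) :
  ~ oset (ds_open p) x -> (fibre_open p : set _) = set0.
Proof. by move=> nxp; apply/seteqP; split=> // xi [/= xu]; case: nxp. Qed.

Lemma fibre_open_sub (p q : DSpaceOb U S) :
  DSpaceHom M p q -> fibre_open q `<=` fibre_open p.
Proof. by move=> g xi; exact: DSpace_set_le g _. Qed.

Lemma over_germ_sub p xp m h : @over_germ p xp m h -> Dset m `<=` fibre_open p.
Proof.
move=> hm; rewrite (fibre_openE xp); exact: Dset_le (push_desc M hm).
Qed.

Lemma push_in_over_germ p xp :
  @over_germ p xp (push M (germ cB F xp) (ds_arr p)) (push_in M _ _).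
Proof. exact: push_inP. Qed.

Lemma over_germ_comp (p q : DSpaceOb U S) xp xq (g : DSpaceHom M p q) m h :
  @over_germ q xq m h -> @over_germ p xp m (h ∘ ds_map g).
Proof.
rewrite /over_germ => hm; rewrite -compA ds_mapP compA hm -compA.
congr (_ ∘ _); exact: germ_restr.
Qed.

Lemma over_germ_post (p : DSpaceOb U S) xp m m' (g : Hom m m') h :
  @over_germ p xp m h -> @over_germ p xp m' (fmap (Dcod U Bx) g ∘ h).
Proof.
rewrite /over_germ => hm; rewrite -compA hm compA; congr (_ ∘ _).
exact: (proj2_sig (g : Hom (sval m) (sval m'))).
Qed.

(* The source of [d] is finitely presented, so its map to the stalk comes from
   a neighbourhood of [x]. *)
Lemma stalk_presentation (m : DCat U Bx) :
  exists (w : Opens X) (xw : oset w x) (k k' : B) (d : Hom k k')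
    (b : Hom k (F w)) (i : Hom k' (Dcod U Bx m)),
    in_D U d /\ is_pushout d (germ cB F xw ∘ b) i (Darr m).
Proof.
have [k [k' [d [a [a' [dD dP]]]]]] := proj2_sig m.
have [_ fk _] := dD.
have [[w xw] [b bE]] := fp_factor (@small_Nbhds X x) (filtered_Nbhds x)
  (@colimP _ cB _ (stalk_diag F x) (@small_Nbhds X x)) fk a.
exists w, xw, k, k', d, b, a'; split=> //.
by rewrite [germ _ _ _ ∘ _]bE.
Qed.

Section Presentation.
Variables (m : DCat U Bx) (w : Opens X) (xw : oset w x).
Variables (k k' : B) (d : Hom k k') (b : Hom k (F w)).
Variable i : Hom k' (Dcod U Bx m).
Hypotheses (dD : in_D U d) (iP : is_pushout d (germ cB F xw ∘ b) i (Darr m)).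

Lemma local_in_D (v : Opens X) :
  @in_D_under A B U (F (cap_open w v)) (MkUnder (local_in2 cB d b v)).
Proof.
exists k, k', d, (local_map b v), (local_in1 cB d b v); split=> //.
exact: local_poP.
Qed.

(** The approximation of [m] at stage [v], an object of the category over the whole space. *)
Definition local_ob (v : Opens X) : DSpaceOb U S :=
  @MkDSpaceOb A B U X S (cap_open w v) (exist _ _ (local_in_D v)).

Lemma local_ob_germ (v : Opens X) (xv : oset v x) :
  @over_germ (local_ob v) (conj xv xw) m (local_leg iP xv).
Proof. exact: local_leg2. Qed.

Definition local_hom (u v : Opens X) (vu : v `<=` u) :
    DSpaceHom M (local_ob u) (local_ob v) :=
  existT _ (@cap_openS _ w _ _ vu) (@push_desc _ _ _ M _ _ _
    (ds_arr (local_ob u)) (ds_arr (local_ob v)) _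
    (local_trans2 cB d b vu)).

Lemma ds_map_local_hom (u v : Opens X) (vu : v `<=` u) :
  ds_map (local_hom vu) = local_trans cB d b vu.
Proof. exact: push_descK. Qed.

(** The arrow of [p] is a pushout of some [e : q -> q'] in D. Finite presentation of [q'] lifts [h]
    on [q'] to some stage, and that of [q] makes the lift compatible with restriction at a smaller
    stage. *)
Lemma local_ob_factor (p : DSpaceOb U S) (xp : oset (ds_open p) x)
    (h : Hom (ds_cod p) (Dcod U Bx m)) : over_germ xp h ->
  exists (v : Opens X) (xv : oset v x) (g : DSpaceHom M p (local_ob v)),
    local_leg iP xv ∘ ds_map g = h.
Proof.
move=> hm; case: p xp h hm => u n xu h hm /=.
have [q [q' [e [a [a' [[_ fq fq'] eP]]]]]] := proj2_sig n.
have sN := @small_Nbhds X x; have fN := filtered_Nbhds x.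
have cN := local_coconeP iP.
have [[v0 xv0] [f0 f0E]] := fp_factor sN fN cN fq' (h ∘ a').
have {}f0E : local_leg iP xv0 ∘ f0 = h ∘ a' by exact: f0E.
(* Shrinking into [u] makes sections over [u] restrictable to this stage. *)
pose v1 : Opens X := cap_open u v0.
have xv1 : oset v1 x := conj xv0 xu.
have v10 : v1 `<=` v0 by move=> y [].
have v1u : cap_open w v1 `<=` u by move=> y [[]].
pose f1 : Hom q' (local_po cB d b v1) := local_trans cB d b v10 ∘ f0.
pose f2 : Hom q (local_po cB d b v1) :=
  local_in2 cB d b v1 ∘ restr F v1u ∘ a.
(* The two maps out of [q] agree in the colimit, though perhaps not at stage [v1]; a smaller [v2]
   makes them equal. *)
have f12 : local_leg iP xv1 ∘ (f1 ∘ e) = local_leg iP xv1 ∘ f2.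
  rewrite /f1 /f2 !compA local_leg_trans f0E -compA eP.1 compA.
  rewrite [X in X ∘ a]hm local_leg2 -!compA; congr (_ ∘ _).
  rewrite compA; congr (_ ∘ _); exact/esym/germ_restr.
have [[v2 xv2] [v21' fE']] :=
  fp_factor_eq sN fN cN fq (i := exist _ v1 xv1) f12.
pose v21 : v2 `<=` v1 := v21'.
have fE : local_trans cB d b v21 ∘ (f1 ∘ e) = local_trans cB d b v21 ∘ f2.
  exact: fE'.
have v2u : cap_open w v2 `<=` u by move=> y [/v21[]].
(* The pushout square of [e] glues the lift on [q'] and the restriction on [F u] into a map out of
   the codomain of [n]. *)
have [|r [[r1 r2] _]] := eP.2 _ (local_trans cB d b v21 ∘ f1)
    (local_in2 cB d b v2 ∘ restr F v2u).
  rewrite -compA fE /f2 !compA local_trans2 -!compA; congr (_ ∘ _).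
  by rewrite compA; congr (_ ∘ _); exact: restr_comp.
exists v2, xv2, (existT _ v2u (@push_desc _ _ _ M _ _ _ n
  (ds_arr (local_ob v2)) r r2)).
rewrite [ds_map _]push_descK.
apply: (pushout_uniq eP).
  by rewrite -compA r1 compA local_leg_trans /f1 compA local_leg_trans.
rewrite -compA r2 compA local_leg2 [RHS]hm -compA; congr (_ ∘ _).
exact: germ_restr.
Qed.

End Presentation.

(** The legs of the colimit presenting [m] are themselves maps over the germ map, and colimit legs
    are jointly epic. *)
Lemma over_germ_jointly_epi (m : DCat U Bx) (e : B)
    (s t : Hom (Dcod U Bx m) e) :
  (forall p xp h, @over_germ p xp m h -> s ∘ h = t ∘ h) -> s = t.
Proof.
move=> st; have [w [xw [k [k' [d [b [i [dD iP]]]]]]]] := stalk_presentation m.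
apply: (colimit_uniq (local_coconeP iP)) => -[v xv].
exact: st (local_ob_germ dD iP xv).
Qed.

(** * The correspondence between families over the space and families over the stalk *)

Section Families.
Variable P : Sh (Spec M Bx) B.
Local Notation Q := (sheaf_psh P).

Definition space_family : Type :=
  forall p : DSpaceOb U S, Hom (ds_cod p) (Q (fibre_open p)).

Definition stalk_family : Type :=
  forall m : DCat U Bx, Hom (Dcod U Bx m) (Q (Dopen M m)).

Definition natural_space_family (t : space_family) : Prop :=
  forall (p q : DSpaceOb U S) (g : DSpaceHom M p q),
    restr Q (fibre_open_sub g) ∘ t p = t q ∘ ds_map g.

Definition natural_stalk_family (t : stalk_family) : Prop :=
  forall (m m' : DCat U Bx) (g : Hom m m'),
    @restr _ _ Q (Dopen M m) (Dopen M m') (Dset_le g) ∘ t m =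
    t m' ∘ fmap (Dcod U Bx) g.

(** The relation expressing that two families correspond. Ranging over all maps over the germ map,
    it involves no choice of presentation of [m]. *)
Definition compatible (t : space_family) (r : stalk_family) : Prop :=
  forall p xp m h (s : Dopen M m `<=` fibre_open p), @over_germ p xp m h ->
    restr Q s ∘ t p = r m ∘ h.

Lemma stalk_family_uniq t r r' :
  compatible t r -> compatible t r' -> forall m, r m = r' m.
Proof.
move=> tr tr' m; apply: over_germ_jointly_epi => p xp h hm.
have s := over_germ_sub hm.
by rewrite -(tr _ _ _ _ s hm) -(tr' _ _ _ _ s hm).
Qed.

(** The component at [m] is induced on the colimit of the approximations [local_ob] by the
    components of [t] there. *)
Lemma stalk_family_ex t : natural_space_family t ->
  exists r, natural_stalk_family r /\ compatible t r.
Proof.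
move=> tN.
(* Naturality need not be built in: it can be tested on the jointly epic maps over the germ map,
   where it follows from compatibility. *)
suff rE (m : DCat U Bx) : exists r : Hom (Dcod U Bx m) (Q (Dopen M m)),
    forall p xp h (s : Dopen M m `<=` fibre_open p), @over_germ p xp m h ->
    restr Q s ∘ t p = r ∘ h.
  pose r m := projT1 (cid (rE m)).
  have tr : compatible t r.
    by move=> p xp m h s; exact: (projT2 (cid (rE m))).
  exists r; split=> // m m' g; apply: over_germ_jointly_epi => p xp h hm.
  have s := over_germ_sub hm; have hm' := over_germ_post g hm.
  have s' := over_germ_sub hm'.
  rewrite -compA -(tr _ _ _ _ s hm) -compA -(tr _ _ _ _ s' hm') compA.
  congr (_ ∘ _); exact: restr_comp.
have [w [xw [k [k' [d [b [i [dD iP]]]]]]]] := stalk_presentation m.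
have sub v (xv : oset v x) : Dopen M m `<=` fibre_open (local_ob b dD v).
  exact: over_germ_sub (local_ob_germ dD iP xv).
pose l v (xv : oset v x) : Hom (local_po cB d b v) (Q (Dopen M m)) :=
  restr Q (sub v xv) ∘ t (local_ob b dD v).
have lN (u v : opposite (Nbhds x)) (vu : Hom u v) :
    l (sval v) (proj2_sig v) ∘ local_trans cB d b vu =
    l (sval u) (proj2_sig u).
  rewrite /l -(ds_map_local_hom b dD vu) -compA -(tN _ _ (local_hom b dD vu)).
  rewrite compA; congr (_ ∘ _); exact: restr_comp.
have [r [rP _]] := local_coconeP iP (@MkCocone _ _ (local_diag cB x d b) _
  (fun v : opposite (Nbhds x) => l (sval v) (proj2_sig v)) lN).
have {}rP v xv : r ∘ local_leg iP xv = l v xv := rP (exist _ v xv).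
(* An arbitrary map over the germ map factors through some approximation, where [r] is known by
   construction. *)
exists r => p xp h s hm; have [v [xv [g <-]]] := local_ob_factor dD iP hm.
rewrite compA rP -compA -(tN _ _ g) compA; congr (_ ∘ _).
exact/esym/restr_comp.
Qed.

(** If [x] lies in the open set of [p], the inclusion is an equality and its restriction map is
    invertible; otherwise the fibre is empty and its sections are terminal. *)
Lemma fibre_open_hom_uniq p (a : B) (s t : Hom a (Q (fibre_open p))) :
  (forall (xp : oset (ds_open p) x)
      (h : Dopen M (push M (germ cB F xp) (ds_arr p)) `<=` fibre_open p),
    restr Q h ∘ s = restr Q h ∘ t) -> s = t.
Proof.
move=> st; have [xp|nxp] := pselect (oset (ds_open p) x); last first.
  exact: sheaf_empty_uniq (proj2_sig P) (fibre_open0 nxp).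
pose m := push M (germ cB F xp) (ds_arr p).
have s1 : Dopen M m `<=` fibre_open p by rewrite (fibre_openE xp).
have s2 : fibre_open p `<=` Dopen M m by rewrite (fibre_openE xp).
have := congr1 (comp (restr Q s2)) (st xp s1).
by rewrite !compA (restr_comp _ _ _ (@subset_refl _ _)) restr_id !comp1c.
Qed.

Lemma space_family_uniq t t' r :
  compatible t r -> compatible t' r -> forall p, t p = t' p.
Proof.
move=> tr tr' p; apply: fibre_open_hom_uniq => xp s.
have hp := push_in_over_germ xp.
by rewrite (tr _ _ _ _ s hp) (tr' _ _ _ _ s hp).
Qed.

(** Compatibility with the pushout injection forces the component at [p]: it is [r] at the
    pushforward, precomposed with that injection. When [x] is outside the open set of [p], the
    terminal object supplies the component. *)
Lemma space_family_ex r : natural_stalk_family r ->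
  exists t, natural_space_family t /\ compatible t r.
Proof.
move=> rN.
suff tE p : exists t : Hom (ds_cod p) (Q (fibre_open p)),
    forall xp m h (s : Dopen M m `<=` fibre_open p), @over_germ p xp m h ->
    restr Q s ∘ t = r m ∘ h.
  pose t p := projT1 (cid (tE p)).
  have tr : compatible t r.
    by move=> p xp m h s; exact: (projT2 (cid (tE p))).
  exists t; split=> // p q g; apply: fibre_open_hom_uniq => xq s.
  have hq := push_in_over_germ xq.
  rewrite [RHS]compA (tr _ _ _ _ s hq) -compA.
  have hp := over_germ_comp (projT1 g x xq) g hq.
  rewrite -(tr _ _ _ _ (over_germ_sub hp) hp) compA; congr (_ ∘ _).
  exact: restr_comp.
have [xp|nxp] := pselect (oset (ds_open p) x); last first.
  have [t _] := sheaf_empty_ex (ds_cod p) (proj2_sig P) (fibre_open0 nxp).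
  by exists t => xp; case: nxp.
pose n := push M (germ cB F xp) (ds_arr p).
have s2 : fibre_open p `<=` Dopen M n by rewrite (fibre_openE xp).
exists (restr Q s2 ∘ (r n ∘ push_in M _ _)) => xp' m h s.
rewrite (Prop_irrelevance xp' xp) => hm.
(* Every map over the germ map factors through the pushforward, which reduces compatibility to
   naturality of [r]. *)
pose g : Hom n m := push_desc M hm.
have hE : h = fmap (Dcod U Bx) g ∘ push_in M _ _ by exact/esym/push_descK.
pose gs : Dopen M m `<=` Dopen M n := Dset_le g.
rewrite hE compA (restr_comp _ _ _ gs) !compA.
by congr (_ ∘ _); exact: rN.
Qed.

End Families.

End StalkSpectrum.

(** * Transfer of the universal property from the space to the stalk *)

Section FibreComparison.
Variables (A B : Category) (U : Functor A B) (M : DiersContext U).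
Variables (X : topologicalType) (S : Sh X B) (x : X).

Local Notation Bx := (bstalk M S x).
Local Notation fibreK := (functor_comp
  (functor_op (preim_functor (@iota_continuous A B U M X S x)))
  (DSpace_functor M S)).

Lemma space_nat_family (P : Sh (Spec M Bx) B)
    (theta : NatTrans (DSpace_cod M S) (functor_comp (sheaf_psh P) fibreK)) :
  natural_space_family (theta : space_family P).
Proof.
move=> p q g; have /= <- := napp_nat theta g.
by congr (_ ∘ _); congr restr; exact: Prop_irrelevance.
Qed.

Lemma stalk_nat_family (P : Sh (Spec M Bx) B)
    (theta : NatTrans (Dcod U Bx)
      (functor_comp (sheaf_psh P) (Dfunctor M Bx))) :
  natural_stalk_family (theta : stalk_family P).
Proof. by move=> m m' g; have /= <- := napp_nat theta g. Qed.

Definition space_nat (P : Sh (Spec M Bx) B) (t : space_family P)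
    (tN : natural_space_family t) :
    NatTrans (DSpace_cod M S) (functor_comp (sheaf_psh P) fibreK).
Proof.
exists t => p q g; rewrite -[RHS]tN; congr (_ ∘ _); congr restr.
exact: Prop_irrelevance.
Defined.

Definition stalk_nat (P : Sh (Spec M Bx) B) (t : stalk_family P)
    (tN : natural_stalk_family t) :
    NatTrans (Dcod U Bx) (functor_comp (sheaf_psh P) (Dfunctor M Bx)) :=
  @MkNatTrans _ _ (Dcod U Bx) (functor_comp (sheaf_psh P) (Dfunctor M Bx)) t tN.

Lemma compatible_map (P Q : Sh (Spec M Bx) B) (s : Hom P Q)
    (t : space_family P) (r : stalk_family P) :
  compatible t r ->
  compatible
    (fun p => (s : PresheafHom _ _) (fibre_open M x p) ∘ t p :
       Hom _ (sheaf_psh Q _))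
    (fun m => (s : PresheafHom _ _) (Dopen M m) ∘ r m : Hom _ (sheaf_psh Q _)).
Proof.
move=> tr p xp m h i hm; rewrite compA.
have e := papp_nat (s : PresheafHom _ _) i.
transitivity ((s : PresheafHom (sheaf_psh P) (sheaf_psh Q)) (Dopen M m) ∘
    restr (sheaf_psh P) i ∘ t p).
  by congr (_ ∘ _).
by rewrite -!compA; congr (_ ∘ _); exact: tr hm.
Qed.

(** Compatibility is a bijection between natural families, stable under composition with sheaf maps,
    so a universal family of one kind corresponds to a universal family of the other. *)
Lemma sheaf_extension_stalk (P : Sh (Spec M Bx) B)
    (eta : NatTrans (DSpace_cod M S) (functor_comp (sheaf_psh P) fibreK)) :
  sheaf_extension eta ->
  exists eta' : NatTrans (Dcod U Bx)
      (functor_comp (sheaf_psh P) (Dfunctor M Bx)), sheaf_extension eta'.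
Proof.
move=> etaP.
have [r [rN tr]] := stalk_family_ex (space_nat_family eta).
exists (stalk_nat rN) => Q theta.
have [t [tN ttheta]] := space_family_ex (stalk_nat_family theta).
have [s [sE su]] := etaP Q (space_nat tN).
(* The map [s] carries [eta] to [t]; since a family has at most one compatible partner, this is
   equivalent to carrying [r] to [theta]. *)
exists s; split.
  apply: (stalk_family_uniq _ ttheta) => p xp m h i hm.
  by rewrite -(compatible_map s tr i hm); congr (_ ∘ _); exact/esym/sE.
move=> s' s'E; apply: su.
apply: (space_family_uniq _ ttheta) => p xp m h i hm.
by rewrite (compatible_map s' tr i hm); congr (_ ∘ _); exact: s'E.
Qed.

End FibreComparison.

Theorem lemma2p11 (A B : Category) (U : Functor A B) (M : DiersContext U)
    (X : topologicalType) (BB : Sh X B) (z : SpecSpace M BB)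
    (tBB : Sh (SpecSpace M BB) B)
    (tBx : Sh (Spec M (bstalk M BB (projT1 z))) B)
    (iBB : Sh (Spec M (bstalk M BB (projT1 z))) B) :
  is_structural_sheaf_space tBB ->
  is_structural_sheaf tBx ->
  is_inverse_image (@iota_continuous A B U M X BB (projT1 z)) tBB iBB ->
  isomorphic iBB tBx.
Proof.
move=> [L [eta [kanL shL]]] [L' [eta' [kanL' shL']]] invP.
(* The universal property is carried from [tBB] to [iBB], rewritten over the stalk, and compared
   with that of [tBx]. *)
have [e1 e1P] := sheafified_kan_extension kanL shL.
have [e2 e2P] := inverse_image_extension e1P invP.
have [e3 e3P] := sheaf_extension_stalk e2P.
have [e4 e4P] := sheafified_kan_extension kanL' shL'.
exact: sheaf_extension_iso e3P e4P.
Qed.
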